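(* For every integer $n\ge 0$, \[ \sum_{k=0}^{\infty}(-1)^{\lceil k/2\rceil}\,\overline{p}_o\!\left(n-\frac{k(k+1)}{2}\right)=\begin{cases}1, & \text{if } n=\frac{m(m+1)}{2} \text{ for some integer } m\ge 0,\\ 0, & \text{otherwise}.\end{cases} \]
   Context: An overpartition of a nonnegative integer $n$ is a partition of $n$ in which the first occurrence of each part size may be overlined. $\overline{p}_o(n)$ denotes the number of overpartitions of $n$ into odd parts; equivalently $\sum_{n\ge0}\overline{p}_o(n)q^n=\frac{(-q;q^2)_\infty}{(q;q^2)_\infty}$, where $(a;q)_\infty=\prod_{k\ge1}(1-aq^{k-1})$. Convention: $\overline{p}_o(x)=0$ whenever $x$ is not a nonnegative integer. *)

(* Defs.v *)
From mathcomp Require Import all_boot all_order all_algebra.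

Set Implicit Arguments.
Unset Strict Implicit.
Unset Printing Implicit Defensive.

(* A sequence of parts (size, overlined?), listed in nonincreasing order of    *)
(* size. The [pairwise] condition reads: an overlined part differs in size     *)
(* from every earlier part, i.e. only first occurrences may be overlined.      *)
Definition is_overpartition (n : nat) (s : seq (nat * bool)) : bool :=
  [&& sorted geq (unzip1 s),
      all (fun p => 0 < p) (unzip1 s),
      pairwise (fun x y => y.2 ==> (y.1 != x.1)) s
    & sumn (unzip1 s) == n].

Definition is_odd_overpartition (n : nat) (s : seq (nat * bool)) : bool :=
  is_overpartition n s && all odd (unzip1 s).

Definition parts_of (n : nat) (t : seq ('I_n.+1 * bool)) : seq (nat * bool) :=
  [seq (val x.1, x.2) | x <- t].

(* An overpartition of n has at most n parts, each at most n; hence nothing is *)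
(* lost by counting among the sequences bounded in this way: see               *)
(* [overpartition_bseq] and [parts_of_inj].                                    *)
Definition pobar (n : nat) : nat :=
  #|[set t : {bseq n of 'I_n.+1 * bool} | is_odd_overpartition n (parts_of t)]|.

Lemma parts_of_inj (n : nat) : injective (@parts_of n).
Proof.
by apply: inj_map => -[i a] [j b] /= [/val_inj -> ->].
Qed.

Lemma overpartition_bseq (n : nat) (s : seq (nat * bool)) :
  is_overpartition n s ->
  exists t : {bseq n of 'I_n.+1 * bool}, parts_of t = s.
Proof.
case/and4P=> _ pos_s _ /eqP sum_s.
have size_s : size s <= n.
  rewrite -sum_s -(size_map fst) -/(unzip1 s).
  elim: (unzip1 s) pos_s => //= a l IH /andP[a0 /IH le_l].
  by rewrite -add1n leq_add.
have le_s x : x \in s -> x.1 <= n.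
  move=> xs; rewrite -sum_s.
  elim: {pos_s sum_s size_s} s xs => //= y l IH.
  rewrite inE => /predU1P[-> | /IH]; first exact: leq_addr.
  by move/leq_trans; apply; exact: leq_addl.
have size_t : size [seq (inord x.1 : 'I_n.+1, x.2) | x <- s] <= n.
  by rewrite size_map.
exists (Bseq size_t); rewrite /parts_of /= -map_comp -[RHS]map_id.
by apply/eq_in_map => -[a b] /le_s /= le_a; rewrite inordK.
Qed.

Definition pobarz (x : int) : int :=
  match x with
  | Posz m => (pobar m)%:Z
  | Negz _ => 0
  end.

Definition triangular (k : nat) : nat := (k * k.+1) %/ 2.

(* Convergence in the discrete ring of integers: the partial sums are          *)
(* eventually equal to l.                                                      *)
Definition has_sumz (u : nat -> int) (l : int) : Prop :=
  exists N0 : nat, forall N : nat, N0 <= N -> (\sum_(k < N) u k = l)%R.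

(* Main.v *)
(** Let [A(q) = (q; q^2)_oo] and [psi(q) = sum_k q^(k(k+1)/2)]. Since
    [(-1)^(uphalf k)] is the parity sign of [k(k+1)/2], the alternating series is
    [psi(-q)], and the claim reads [psi(-q) A(-q) / A(q) = psi(q)]. By Gauss,
    [A(q) psi(q) = (q^2; q^2)_oo], which is even in [q]; hence
    [A(q) psi(q) = A(-q) psi(-q)], and [A(q)] can be cancelled. Gauss's identity
    is obtained modulo [q^(2n+1)] from a finite identity of Shanks, proved by a
    telescoping induction. *)

Require Import Defs.
From mathcomp Require Import all_boot all_order all_algebra.
From mathcomp Require Import zify ring.

Set Implicit Arguments.
Unset Strict Implicit.

Import GRing.Theory.

(** * Enumeration of odd overpartitions by largest part *)

Local Open Scope nat_scope.

(** Odd parts below [m.*2] lie among 1, 3, ..., 2m-1, so [m] counts the admissible sizes. *)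
Definition opart_below (m n : nat) (s : seq (nat * bool)) : bool :=
  is_odd_overpartition n s && all (fun p => p < m.*2) (unzip1 s).

(** For odd [p], [(uphalf p).*2] is p+1: the tail may repeat [p], but only without overline, since
    its copies of [p] are not first. *)
Lemma opart_below_cons (m n p : nat) (b : bool) (s : seq (nat * bool)) :
  opart_below m n ((p, b) :: s) =
  [&& odd p, p < m.*2, p <= n, (p, true) \notin s
    & opart_below (uphalf p) (n - p) s].
Proof.
rewrite /opart_below /is_odd_overpartition /is_overpartition /=.
have -> : path geq p (unzip1 s) =
    all (geq p) (unzip1 s) && sorted geq (unzip1 s).
  by rewrite path_sortedE // => x y z /= xy yz; exact: leq_trans yz xy.
have -> : all (fun y : nat * bool => y.2 ==> (y.1 != p)) s = ((p, true) \notin s).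
  rewrite -has_pred1 -all_predC; apply: eq_all => -[q c] /=.
  by rewrite xpair_eqE; case: c => /=; rewrite ?andbT ?andbF.
case: (boolP (odd p)) => op; last by rewrite !(andbF, andFb).
have -> : all (fun q => q < (uphalf p).*2) (unzip1 s) = all (geq p) (unzip1 s).
  by apply: eq_all => q /=; lia.
have p0 : 0 < p by lia.
rewrite p0 /=.
have -> : (p + sumn (unzip1 s) == n) = (p <= n) && (sumn (unzip1 s) == n - p).
  by lia.
case: (boolP (all (geq p) _)) => /= [ap|]; last by rewrite !andbF.
case: (boolP (p < m.*2)) => /= pm; last by rewrite !andbF.
have -> : all (fun q => q < m.*2) (unzip1 s).
  by apply: sub_all ap => q /=; lia.
rewrite !andbT; apply/idP/idP.
  by case/andP=> /and5P[-> -> /andP[-> ->] -> ->] ->.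
by case/and4P=> -> -> /and4P[-> -> -> ->] ->.
Qed.

Lemma opart_below_notin (m n k : nat) (b : bool) (s : seq (nat * bool)) :
  m.*2 <= k -> opart_below m n s -> (k, b) \notin s.
Proof.
move=> mk /andP[_ /allP lt_s]; apply/negP => /(map_f fst)/lt_s /=; lia.
Qed.

Lemma opart_below0 (n : nat) (s : seq (nat * bool)) :
  opart_below 0 n s = (n == 0) && (s == [::]).
Proof.
by case: s => [|[p b] s]; [case: n | rewrite opart_below_cons ltn0 !andbF].
Qed.

Lemma opart_belowS (m n p : nat) (b : bool) (s : seq (nat * bool)) :
  p != m.*2.+1 ->
  opart_below m.+1 n ((p, b) :: s) = opart_below m n ((p, b) :: s).
Proof.
move=> pm; rewrite !opart_below_cons doubleS.
by case: (boolP (odd p)) => //= op; congr andb; lia.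
Qed.

Lemma opart_below_cons_max (m n : nat) (b : bool) (s : seq (nat * bool)) :
  opart_below m.+1 n ((m.*2.+1, b) :: s) =
  [&& m.*2.+1 <= n, opart_below m.+1 (n - m.*2.+1) s
    & (m.*2.+1, true) \notin s].
Proof.
rewrite opart_below_cons doubleS ltnSn.
have -> : odd m.*2.+1 by lia.
have -> : uphalf m.*2.+1 = m.+1 by lia.
by rewrite /= [X in _ && X]andbC.
Qed.

(* [f] is fuel: every [f >= n] gives the same list when [0 < k]. With
   [E] the lists without an overlined [k], those with parts at most [k] number
   [E n + E (n - k)], while [E n = D n + E (n - k)]; this gives the factor
   [(1 + q^k) / (1 - q^k)] of the generating function. *)
Fixpoint plain_extend (k : nat) (D : nat -> seq (seq (nat * bool))) (f n : nat) :
    seq (seq (nat * bool)) :=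
  D n ++ (if f is f'.+1 then
            if k <= n then
              [seq (k, false) :: t | t <- plain_extend k D f' (n - k)]
            else [::]
          else [::]).

(** As [k] is the largest admissible size, an overlined [k] can only head the list, and none follows
    it. *)
Fixpoint oparts (m n : nat) : seq (seq (nat * bool)) :=
  if m is m'.+1 then
    let k := m'.*2.+1 in
    let E := fun i => plain_extend k (oparts m') i i in
    E n ++ (if k <= n then [seq (k, true) :: t | t <- E (n - k)] else [::])
  else if n == 0 then [:: [::]] else [::].

Lemma plain_extend_fuel (k f n : nat) (D : nat -> seq (seq (nat * bool))) :
  0 < k -> n <= f -> plain_extend k D f n = plain_extend k D n n.
Proof.
move=> k0; elim/ltn_ind: n f => -[|n] IH [|f] //= nf.
  by rewrite leqNgt k0.
by case: ifP => // kn; congr (_ ++ map _ _); rewrite IH ?[RHS]IH //; lia.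
Qed.

Lemma mem_map_cons (T : eqType) (x : T) (l : seq (seq T)) (s : seq T) :
  (s \in [seq x :: t | t <- l]) =
  if s is y :: s' then (y == x) && (s' \in l) else false.
Proof.
apply/mapP/idP => [[t tl ->]|]; first by rewrite eqxx.
by case: s => // y s /andP[/eqP-> sl]; exists s.
Qed.

Lemma mem_plain_extend (m f n : nat) (D : nat -> seq (seq (nat * bool)))
    (s : seq (nat * bool)) :
  (forall i t, (t \in D i) = opart_below m i t) -> n <= f ->
  (s \in plain_extend m.*2.+1 D f n) =
  opart_below m.+1 n s && ((m.*2.+1, true) \notin s).
Proof.
move=> memD; elim: f n s => [|f IH] n s nf /=; rewrite mem_cat memD.
  have -> : n = 0 by lia.
  case: s => [|[p b] s] //.
  by rewrite !opart_below_cons; case: p => //= p; rewrite !andbF.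
set k := m.*2.+1.
have -> : (s \in (if k <= n then
      [seq (k, false) :: t | t <- plain_extend k D f (n - k)] else [::])) =
    if s is y :: s' then [&& k <= n, y == (k, false)
      & s' \in plain_extend k D f (n - k)] else false.
  by case: ifP => kn; rewrite ?mem_map_cons //; case: s.
case: s => [|[p b] s]; first by rewrite orbF andbT.
case: (eqVneq p k) => [->|pk].
  rewrite opart_below_cons_max opart_below_cons ltnNge leqnSn /= andbF /=.
  case: (boolP (k <= n)) => //= kn.
  rewrite IH; last by lia.
  rewrite xpair_eqE inE xpair_eqE !eqxx /= negb_or.
  by case: b; rewrite ?andbF //= -andbA andbb.
rewrite xpair_eqE (negPf pk) !andbF orbF opart_belowS //.
by apply/esym/andb_idr/opart_below_notin.
Qed.

Lemma mem_oparts (m n : nat) (s : seq (nat * bool)) :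
  (s \in oparts m n) = opart_below m n s.
Proof.
elim: m n s => [|m IH] n s; first by rewrite opart_below0 /=; case: (n == 0); rewrite ?inE.
rewrite [oparts _ _]/=; set k := m.*2.+1; rewrite mem_cat mem_plain_extend //.
have -> : (s \in (if k <= n then [seq (k, true) :: t
      | t <- plain_extend k (oparts m) (n - k) (n - k)] else [::])) =
    if s is y :: s' then [&& k <= n, y == (k, true),
      opart_below m.+1 (n - k) s' & (k, true) \notin s'] else false.
  by case: ifP => kn; rewrite ?mem_map_cons //; case: s => // y s;
     rewrite mem_plain_extend.
case: s => [|[p b] s]; first by rewrite orbF andbT.
case: (eqVneq p k) => [->|pk].
  rewrite opart_below_cons_max -/k inE !xpair_eqE !eqxx /= negb_or.
  by case: b => /=; rewrite ?andbF //= orbF -!andbA andbb.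
rewrite xpair_eqE (negPf pk) !andbF orbF; apply/andb_idr.
by rewrite opart_belowS //; exact: opart_below_notin.
Qed.

Lemma uniq_map_cons (T : eqType) (x : T) (l : seq (seq T)) :
  uniq [seq x :: t | t <- l] = uniq l.
Proof. by apply: map_inj_uniq => s t []. Qed.

Lemma uniq_plain_extend (m f n : nat) :
  (forall i, uniq (oparts m i)) ->
  uniq (plain_extend m.*2.+1 (oparts m) f n).
Proof.
move=> uD; elim: f n => [|f IH] n /=; rewrite ?cats0 // cat_uniq uD /=.
case: ifP => // _; rewrite uniq_map_cons IH andbT.
(* The two blocks are disjoint: lists in [oparts m] have no part [m.*2.+1]. *)
apply/hasPn => s; rewrite mem_map_cons mem_oparts.
case: s => // y s /andP[/eqP-> _]; apply/negP => /opart_below_notin.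
by move=> /(_ m.*2.+1 false (leqnSn _)); rewrite inE eqxx.
Qed.

Lemma uniq_oparts (m n : nat) : uniq (oparts m n).
Proof.
elim: m n => [|m IH] n; first by rewrite /=; case: eqP.
rewrite [oparts _ _]/= cat_uniq uniq_plain_extend //=.
case: ifP => // _; rewrite uniq_map_cons uniq_plain_extend // andbT.
apply/hasPn => s; rewrite mem_map_cons mem_plain_extend //;
  last exact: mem_oparts.
by case: s => // y s /andP[/eqP-> _]; rewrite inE eqxx andbF.
Qed.

Lemma pobar_oparts (m n : nat) : n <= m -> pobar n = size (oparts m n).
Proof.
move=> nm; rewrite /pobar cardE -(size_map (fun t => parts_of (val t))).
apply/perm_size/uniq_perm; first 2 last.
- move=> s; rewrite mem_oparts; apply/mapP/idP => [[t]|].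
    rewrite mem_enum inE => tn ->; rewrite /opart_below tn /=.
    (* A part p satisfies p <= n <= m, and its positivity gives m < 2m. *)
    have /andP[/and4P[_ pos _ _] _] := tn.
    apply/allP => p pt; have p0 := allP pos _ pt.
    move/mapP: pt => [_ /mapP[x _ ->] /= ep].
    move: (ltn_ord x.1) p0; rewrite {}ep; move: (nat_of_ord x.1) => q; lia.
  case/andP=> on _; have /andP[/overpartition_bseq[t et] _] := on.
  by exists t; rewrite // mem_enum inE et.
- rewrite map_inj_uniq ?enum_uniq // => t u /parts_of_inj; exact: val_inj.
- exact: uniq_oparts.
Qed.

(** * Truncated power series *)

Local Open Scope ring_scope.

Definition eqmodX (R : nzRingType) (M : nat) (p q : {poly R}) : Prop :=
  forall i, (i < M)%N -> p`_i = q`_i.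

Lemma eqmodX_trans (R : nzRingType) (M : nat) (p q r : {poly R}) :
  eqmodX M p q -> eqmodX M q r -> eqmodX M p r.
Proof. by move=> pq qr i iM; rewrite pq ?qr. Qed.

Lemma eqmodX_sym (R : nzRingType) (M : nat) (p q : {poly R}) :
  eqmodX M p q -> eqmodX M q p.
Proof. by move=> pq i iM; rewrite pq. Qed.

Lemma eqmodX_leq (R : nzRingType) (M N : nat) (p q : {poly R}) :
  (M <= N)%N -> eqmodX N p q -> eqmodX M p q.
Proof. by move=> MN pq i iM; apply/pq/(leq_trans iM). Qed.

Lemma eqmodX_mull (R : nzRingType) (M : nat) (r p q : {poly R}) :
  eqmodX M p q -> eqmodX M (r * p) (r * q).
Proof.
move=> pq i iM; rewrite !coefM; apply: eq_bigr => j _.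
by rewrite pq // (leq_ltn_trans (leq_subr _ _)).
Qed.

(** The coefficient of degree i of [r * p] is that of [p] plus terms in earlier coefficients of [p],
    so strong induction applies. *)
Lemma eqmodX_mull_cancel (R : nzRingType) (M : nat) (r p q : {poly R}) :
  r`_0 = 1 -> eqmodX M (r * p) (r * q) -> eqmodX M p q.
Proof.
move=> r0 rpq; elim/ltn_ind => i IH iM; have := rpq i iM.
rewrite !coefM !big_ord_recl /= subn0 r0 !mul1r.
rewrite (eq_bigr (fun j : 'I_i => r`_(bump 0 j) * q`_(i - bump 0 j))).
  exact: addIr.
by move=> j _; rewrite IH // /bump /=; have := ltn_ord j; lia.
Qed.

(** The finite product (x; x^2)_n, a truncation of A(x). *)
Definition odd_qprod (R : comNzRingType) (x : R) (n : nat) : R :=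
  \prod_(j < n) (1 - x ^+ j.*2.+1).

Lemma odd_qprodS (R : comNzRingType) (x : R) (n : nat) :
  odd_qprod x n.+1 = odd_qprod x n * (1 - x ^+ n.*2.+1).
Proof. exact: big_ord_recr. Qed.

Definition opart_gf (M m : nat) : {poly int} :=
  \poly_(n < M) (size (oparts m n))%:R.

(** The series [g] of lists without overlined [k] links both sides: an optional overlined [k] in
    front gives 1 + X^k, and removing a plain leading [k] gives 1 - X^k. *)
Lemma opart_gfS (M m : nat) :
  eqmodX M ((1 - 'X^(m.*2.+1)) * opart_gf M m.+1)
           ((1 + 'X^(m.*2.+1)) * opart_gf M m).
Proof.
set k := m.*2.+1.
pose E n := plain_extend k (oparts m) n n.
pose g : {poly int} := \poly_(n < M) (size (E n))%:R.
have gD : eqmodX M (opart_gf M m.+1) ((1 + 'X^k) * g).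
  move=> i iM; rewrite mulrDl mul1r coefD coefXnM !coef_poly iM /= -/k size_cat.
  rewrite natrD; congr (_ + _); case: (leqP k i) => // ki.
  by rewrite size_map (leq_ltn_trans (leq_subr _ _) iM).
have gE : eqmodX M ((1 - 'X^k) * g) (opart_gf M m).
  move=> i iM; rewrite mulrBl mul1r coefB coefXnM !coef_poly iM.
  rewrite (leq_ltn_trans (leq_subr _ _) iM).
  apply/eqP; rewrite subr_eq; apply/eqP.
  case: i iM => [|i] iM; first by rewrite /E /= cats0 addr0.
  rewrite /E /= size_cat natrD; congr (_ + _).
  case: (leqP k i.+1) => // ki; rewrite size_map plain_extend_fuel //.
  by lia.
apply: (eqmodX_trans (eqmodX_mull _ gD)).
by rewrite mulrCA; apply: eqmodX_mull.
Qed.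

(** The product formula A(-q)/A(q) with its denominator cleared; the exponents are odd, so -X turns
    each 1 - X^k into 1 + X^k. *)
Lemma opart_gf_qprod (M m : nat) :
  eqmodX M (odd_qprod 'X m * opart_gf M m) (odd_qprod (- 'X) m).
Proof.
elim: m => [|m IH].
  rewrite /odd_qprod !big_ord0 mul1r => i iM.
  by rewrite coef_poly iM coef1; case: i {iM}.
have -> : odd_qprod (- 'X) m.+1 = (1 + 'X^(m.*2.+1)) * odd_qprod (- 'X) m
    :> {poly int}.
  by rewrite odd_qprodS mulrC exprNn -signr_odd /= odd_double mulN1r opprK.
rewrite odd_qprodS -mulrA.
apply: (eqmodX_trans (eqmodX_mull _ (@opart_gfS M m))).
by rewrite mulrCA; apply: eqmodX_mull.
Qed.

(** * Shanks' finite form of Gauss's triangular number identity *)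

Lemma triangularS (k : nat) : triangular k.+1 = (triangular k + k.+1)%N.
Proof. by rewrite addnC /triangular -divnMDl //; congr divn; lia. Qed.

Lemma triangular_double_succ (n : nat) :
  triangular n.*2.+1 = (n.+1 * n.*2.+1)%N.
Proof.
by rewrite /triangular -[RHS](@mulnK _ 2) //; congr divn; lia.
Qed.

(** Shanks' identity cleared of denominators: the product over [s <= j < n] stands for (x^2; x^2)_n
    / (x^2; x^2)_s. *)
Lemma triangular_sum_qprod (R : comNzRingType) (x : R) (n : nat) :
  odd_qprod x n * \sum_(k < n.*2.+1) x ^+ triangular k =
  \sum_(0 <= s < n.+1)
     (\prod_(s <= j < n) (1 - x ^+ j.+1.*2)) * odd_qprod x s
     * x ^+ (s * n.*2.+1).
Proof.
elim: n => [|n IH].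
  by rewrite /odd_qprod big_ord0 big_ord1 big_nat1 big_geq // big_ord0 !mul1r.
pose C s := \prod_(s <= j < n) (1 - x ^+ j.+1.*2).
(* In the induction step the two sides differ by the sum of [t s.+1 - t s]. *)
pose t s := if s is s'.+1 then C s' * odd_qprod x s * x ^+ (s * n.*2.+1) else 0.
rewrite doubleS 2!big_ord_recr big_nat_recr //= (triangularS n.*2.+1).
rewrite triangular_double_succ mulrDr; congr (_ + _); last first.
  (* The terms k = 2n+2 and s = n+1 agree, both with exponent (n+1)(2n+3). *)
  by rewrite [in RHS]big_geq // mul1r; congr (_ * x ^+ _); lia.
rewrite mulrDr {1}odd_qprodS mulrAC IH.
(* The remaining term k = 2n+1 is [t n.+1]; telescoping from [t 0 = 0] allows a comparison term by
   term in [s]. *)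
have -> : odd_qprod x n.+1 * x ^+ (n.+1 * n.*2.+1) =
    \sum_(0 <= s < n.+1) (t s.+1 - t s).
  by rewrite telescope_sumr //= subr0 /C big_geq // mul1r.
rewrite mulr_suml -big_split /=; apply: eq_big_nat => s /andP[_ sn].
have -> : \prod_(s <= j < n.+1) (1 - x ^+ j.+1.*2) = C s * (1 - x ^+ n.*2.+2).
  by rewrite big_nat_recr.
(* The factor [1 - x ^+ s.*2] vanishes at [s = 0], so one formula covers both cases of [t]. *)
have -> : t s = C s * (1 - x ^+ s.*2) * odd_qprod x s * x ^+ (s * n.*2.+1).
  case: s sn => [|s] sn; first by rewrite double0 expr0 subrr mulr0 !mul0r.
  by rewrite /t /C [X in X * _ * _]big_ltn // [X in X * _ * _]mulrC.
rewrite /t odd_qprodS mulSn exprD.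
have -> : (s * n.*2.+3 = s * n.*2.+1 + s.*2)%N by lia.
rewrite exprD !exprS -/(C s); ring.
Qed.

(** Terms with s >= 1 in Shanks' identity are divisible by X^(2n+1), so only s = 0 survives. The
    factor [y] serves X and -X at once. *)
Lemma triangular_sum_qprod_modX (R : comNzRingType) (y : {poly R}) (n : nat) :
  eqmodX n.*2.+1
    (odd_qprod (y * 'X) n * \sum_(k < n.*2.+1) (y * 'X) ^+ triangular k)
    (\prod_(0 <= j < n) (1 - (y * 'X) ^+ j.+1.*2)).
Proof.
move=> i iM; rewrite triangular_sum_qprod big_nat_recl //= coefD.
rewrite [odd_qprod _ 0]big_ord0 !mulr1 coef_sum [X in _ + X]big1 ?addr0 // => s _.
by rewrite exprMn mulrA coefMXn (leq_trans iM) // mulSn leq_addr.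
Qed.

(** * Comparison of X with -X and extraction of coefficients *)

Lemma odd_qprod_coef0 (n : nat) : (odd_qprod 'X n : {poly int})`_0 = 1.
Proof.
rewrite -horner_coef0 horner_prod big1 // => j _.
by rewrite !hornerE expr0n subr0.
Qed.

Lemma sign_triangular (k : nat) : (-1) ^+ triangular k = (-1) ^+ uphalf k :> int.
Proof.
rewrite -signr_odd -[RHS]signr_odd; congr (_ ^+ nat_of_bool _).
elim: k => // k IH; rewrite triangularS oddD IH; lia.
Qed.

Lemma leq_triangular (k : nat) : (k <= triangular k)%N.
Proof. by elim: k => // k IH; rewrite triangularS; lia. Qed.

Lemma triangular_inj : injective triangular.
Proof.
have H j k : (j < k)%N -> (triangular j < triangular k)%N.
  by elim: k => // k IH; rewrite ltnS leq_eqVlt => /predU1P[->|/IH];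
     rewrite triangularS; lia.
by move=> j k e; case: (ltngtP j k) => // /H; rewrite e ltnn.
Qed.

Lemma pobar_triangular_sum (n : nat) :
  \sum_(k < n.*2.+1)
    (-1) ^+ uphalf k * pobarz (n%:Z - (triangular k)%:Z) =
  \sum_(k < n.*2.+1) (n == triangular k)%:R.
Proof.
pose psi (x : {poly int}) := \sum_(k < n.*2.+1) x ^+ triangular k.
have Hpsi (y : {poly int}) : eqmodX n.+1 (odd_qprod (y * 'X) n * psi (y * 'X))
    (\prod_(0 <= j < n) (1 - (y * 'X) ^+ j.+1.*2)).
  by apply: eqmodX_leq (@triangular_sum_qprod_modX _ y n); lia.
have psiX := Hpsi 1; have psiNX := Hpsi (-1); rewrite mul1r in psiX.
have even_x : \prod_(0 <= j < n) (1 - (-1 * 'X) ^+ j.+1.*2) =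
    \prod_(0 <= j < n) (1 - 'X ^+ j.+1.*2) :> {poly int}.
  apply: eq_bigr => j _; rewrite mulN1r exprNn -signr_odd odd_double.
  by rewrite expr0 mul1r.
rewrite even_x mulN1r in psiNX.
(* Multiplied by [odd_qprod 'X n], both sides become the same even product. *)
have key : eqmodX n.+1 (psi (- 'X) * opart_gf n.+1 n) (psi 'X).
  apply: (eqmodX_mull_cancel (odd_qprod_coef0 n)); rewrite mulrCA.
  apply: (eqmodX_trans (eqmodX_mull _ (@opart_gf_qprod _ _))).
  by rewrite mulrC; apply: (eqmodX_trans psiNX); apply: eqmodX_sym.
have := key n (ltnSn n); rewrite mulr_suml !coef_sum.
move=> e; transitivity (\sum_(k < n.*2.+1) ('X ^+ triangular k : {poly int})`_n).
  rewrite -e; apply: eq_bigr => k _.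
  have -> : (- 'X) ^+ triangular k = ((-1) ^+ uphalf k)%:P * 'X^(triangular k)
      :> {poly int}.
    by rewrite [in LHS]exprNn -sign_triangular polyC_exp polyCN.
  rewrite -mulrA coefCM coefXnM.
  congr (_ * _); case: (leqP (triangular k) n) => tn.
    rewrite subzn //= coef_poly ltnS leq_subr (@pobar_oparts n) ?leq_subr //.
    by rewrite natz.
  (* Here [triangular k] exceeds [n], and [pobarz] vanishes at negative arguments. *)
  by case E: (n%:Z - _) => [j|//]; lia.
by apply: eq_bigr => k _; rewrite coefXn.
Qed.

Theorem theorem1p4 (n : nat) :
  let u := fun k : nat => (-1) ^+ uphalf k * pobarz (n%:Z - (triangular k)%:Z) in
  ((exists m : nat, n = triangular m) -> has_sumz u 1) /\
  (~ (exists m : nat, n = triangular m) -> has_sumz u 0).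
Proof.
move=> u.
(* For k > 2n, [triangular k] >= k > n, so the later terms vanish. *)
have sumE N : (n.*2.+1 <= N)%N ->
    \sum_(k < N) u k = \sum_(k < n.*2.+1) (n == triangular k)%:R.
  move=> nN; rewrite -pobar_triangular_sum -!(big_mkord xpredT u).
  rewrite (big_cat_nat (leq0n _) nN) /= [X in _ + X]big_nat_cond [X in _ + X]big1 ?addr0 //.
  move=> k /andP[/andP[nk _] _]; rewrite /u.
  case E: (n%:Z - _) => [j|j]; last by rewrite mulr0.
  by have := leq_triangular k; lia.
split=> [[m nm]|nex]; exists n.*2.+1 => N /sumE ->.
  have mn : (m < n.*2.+1)%N by have := leq_triangular m; lia.
  (* By injectivity of [triangular], only the index [m] contributes. *)
  rewrite (bigD1 (Ordinal mn)) //= -nm eqxx big1 ?addr0 // => k km.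
  case: eqP => // nk; case/eqP: km; apply: val_inj.
  by apply: triangular_inj; rewrite -nk.
by rewrite big1 // => k _; case: eqP => // nk; case: nex; exists k.
Qed.
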